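(* Let $q\in\{2,4\}$. Let $C_1=[n_1,k_1,d_1]_q$ be a linear code over $GF(q)$ with $\rho_1=n_1-k_1$ check symbols, and let $C_2=[n_2,k_2,d_2]_{q^{\rho_1}}$ be a linear code over the extension field $GF(q^{\rho_1})$ with $\rho_2=n_2-k_2$ check symbols. Let $\mathcal{C}=C_2\otimes_H C_1$ be the tensor product code of $C_1$ and $C_2$, and let $\psi(C_2)$ be the subfield subcode of $C_2$ over $GF(q)$. (a) If $C_1^{\perp}\subseteq C_1$ (or $\psi(C_2)^{\perp}\subseteq \psi(C_2)$), then $\mathcal{C}^{\perp}\subseteq\mathcal{C}$. (b) If $q=4$ and $C_1^{\perp_h}\subseteq C_1$ (or $\psi(C_2)^{\perp_h}\subseteq\psi(C_2)$), then $\mathcal{C}^{\perp_h}\subseteq\mathcal{C}$.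
   Context: $[n,k,d]_q$ denotes a linear code over $GF(q)$ of length $n$, dimension $k$ and minimum distance $d$. $C^\perp$ is the dual with respect to the Euclidean inner product $\sum_i u_iv_i$; for $q=4$, $C^{\perp_h}$ is the dual with respect to the Hermitian inner product $(u,v)_h=\sum_i u_iv_i^2$. Let $\alpha$ be a primitive element of $GF(q^{\rho_1})$. The map $\psi:GF(q^{\rho_1})\to GF(q)^{\rho_1}$ is the bijection $\psi(a_0+a_1\alpha+\cdots+a_{\rho_1-1}\alpha^{\rho_1-1})=(a_0,a_1,\ldots,a_{\rho_1-1})^T$ with $a_i\in GF(q)$. For a matrix $H=(\alpha_{ij})_{k\times n}$ over $GF(q^{\rho_1})$, $\psi(H)=(\psi(\alpha_{ij}))$ is the $k\rho_1\times n$ matrix over $GF(q)$ obtained by replacing each entry by its column vector. For a linear code $C$ over $GF(q^{\rho_1})$ with parity check matrix $H$, $\psi(C)$ denotes the linear code over $GF(q)$ with parity check matrix $\psi(H)$ (its null space over $GF(q)$), i.e. the subfield subcode of $C$ over $GF(q)$. For a $\rho_1\times n$ matrix $H_{c_1}$ over $GF(q)$, $\psi^{-1}(H_{c_1})$ is the $1\times n$ matrix over $GF(q^{\rho_1})$ obtained by applying $\psi^{-1}$ to each column. Tensor product code: let $H_{c_1}$ be a $\rho_1\times n_1$ parity check matrix of $C_1$ over $GF(q)$ and $H_{c_2}$ a $\rho_2\times n_2$ parity check matrix of $C_2$ over $GF(q^{\rho_1})$. Put $H_{\mathcal{C}}=H_{c_2}\otimes\psi^{-1}(H_{c_1})$,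 a $\rho_2\times n_1n_2$ matrix over $GF(q^{\rho_1})$ ($\otimes$ is the Kronecker product). Then $\mathcal{C}=C_2\otimes_H C_1$ is the linear code of length $n_1n_2$ over $GF(q)$ whose parity check matrix is the $\rho_1\rho_2\times n_1n_2$ matrix $\psi(H_{\mathcal{C}})$. *)

(* Defs.v *)
From HB Require Import structures.
From mathcomp Require Import all_boot all_order all_algebra all_field.
From mathcomp Require Import mxtens.

Set Implicit Arguments.
Unset Strict Implicit.
Unset Printing Implicit Defensive.

Import GRing.Theory.
Local Open Scope ring_scope.

Section LinearCodes.

Variables (K : fieldType) (n : nat).
Implicit Types (C : {vspace 'rV[K]_n}) (u v : 'rV[K]_n).

Definition hamming_weight v : nat := #|[set i | v 0 i != 0]|.

(* The zero code has no nonzero codeword; every d is accepted for it. *)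
Definition min_distance C (d : nat) : Prop :=
  (forall v, v \in C -> v != 0 -> (d <= hamming_weight v)%N) /\
  (C != 0%VS -> exists v, [/\ v \in C, v != 0 & hamming_weight v = d]).

Definition linear_code C (k d : nat) : Prop := \dim C = k /\ min_distance C d.

(* Codewords are row vectors, so H acts on v as v *m H^T. *)
Definition null_code (m : nat) (H : 'M[K]_(m, n)) : {vspace 'rV[K]_n} :=
  lker (linfun (mulmxr H^T)).

Lemma mem_null_code (m : nat) (H : 'M[K]_(m, n)) v :
  (v \in null_code H) = (v *m H^T == 0).
Proof. by rewrite memv_ker lfunE. Qed.

(* When m = n - \dim C, the rows of such an H are linearly independent. *)
Definition parity_check_matrix (m : nat) C (H : 'M[K]_(m, n)) : Prop :=
  null_code H = C.

Definition euclid_prod u v : K := \sum_(i < n) u 0 i * v 0 i.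

(* Only meaningful over GF(4), where x |-> x ^+ 2 is the conjugation. *)
Definition herm_prod u v : K := \sum_(i < n) u 0 i * v 0 i ^+ 2.

Definition euclid_dual C v : Prop := forall u, u \in C -> euclid_prod u v = 0.

Definition herm_dual C v : Prop := forall u, u \in C -> herm_prod u v = 0.

Definition euclid_dual_containing C : Prop :=
  forall v, euclid_dual C v -> v \in C.

Definition herm_dual_containing C : Prop :=
  forall v, herm_dual C v -> v \in C.

End LinearCodes.

Section TensorProductCodes.

Variables (F : finFieldType) (L : fieldExtType F) (alpha : L).

Definition power_tuple (m : nat) : m.-tuple L := [tuple alpha ^+ i | i < m].

(* coord gives the coordinates of x only if power_tuple m is a basis of L;
   power_basis below shows that this holds when alpha is a primitive element
   and m is the degree of L over F. *)
Definition psi (m : nat) (x : L) : 'cV[F]_m :=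
  \col_i coord (power_tuple m) i x.

Definition psi_inv (m : nat) (a : 'cV[F]_m) : L :=
  \sum_(i < m) a i 0 *: alpha ^+ i.

(* Row i of H becomes the rows i * m, ..., i * m + m - 1. *)
Definition psi_mx (m k n : nat) (H : 'M[L]_(k, n)) : 'M[F]_(k * m, n) :=
  \matrix_(r, j) psi m (H (mxtens_unindex r).1 j) (mxtens_unindex r).2 0.

Definition psi_inv_mx (m n : nat) (H : 'M[F]_(m, n)) : 'M[L]_(1, n) :=
  \row_j psi_inv (col j H).

Definition subfield_code (m k n : nat) (H : 'M[L]_(k, n)) :
    {vspace 'rV[F]_n} :=
  null_code (psi_mx m H).

Definition tensor_product_code (m k n1 n2 : nat)
    (H2 : 'M[L]_(k, n2)) (H1 : 'M[F]_(m, n1)) : {vspace 'rV[F]_(n2 * n1)} :=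
  null_code (psi_mx m (tensmx H2 (psi_inv_mx H1))).

Lemma power_basis (m : nat) :
  \dim {:L} = m -> (#|F| ^ m).-1.-primitive_root alpha ->
  basis_of {:L} (power_tuple m).
Proof.
move=> dimL prim; have F1 : (1 < #|F|)%N := finNzRing_gt1 F.
have gt0 := prim_order_gt0 prim.
have alpha0 : alpha != 0.
  apply/eqP => a0; have := prim_expr_order prim.
  rewrite a0 expr0n eqn0Ngt gt0 => /esym/eqP.
  by rewrite oner_eq0.
set K := <<1%VS; alpha>>%AS.
have Kgt0 : (0 < \dim K)%N by exact: adim_gt0.
have m_le : (m <= \dim K)%N.
  have : ((#|F| ^ m).-1 %| (#|F| ^ \dim K).-1)%N.
    rewrite (prim_order_dvd prim) -(inj_eq (mulfI alpha0)) -exprS mulr1.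
    rewrite prednK ?expn_gt0 ?(ltnW F1) //.
    by rewrite -(Fermat's_little_theorem K) memv_adjoin.
  have lt1 : (1 < #|F| ^ \dim K)%N by rewrite -(expn0 #|F|) ltn_exp2l.
  have pos : (0 < (#|F| ^ \dim K).-1)%N by rewrite -ltnS prednK // ltnW.
  move/(dvdn_leq pos); rewrite -ltnS !prednK ?expn_gt0 ?(ltnW F1) //.
  by rewrite leq_exp2l.
have K_le : (\dim K <= m)%N by rewrite -dimL dimvS ?subvf.
have deg : adjoin_degree 1 alpha = m.
  have := dim_Fadjoin 1%AS alpha; rewrite dimv1 muln1 => <-.
  by apply/eqP; rewrite eqn_leq K_le.
have KL : <<1; alpha>>%VS = fullv.
  by apply/eqP; rewrite eqEdim subvf dimL.
rewrite basisEdim size_tuple dimL leqnn andbT; apply/subvP => x _.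
have /Fadjoin_poly_eq <- : x \in <<1; alpha>>%VS by rewrite KL memvf.
have szp : (size (Fadjoin_poly 1 alpha x) <= m)%N.
  by rewrite -deg size_Fadjoin_poly.
rewrite (horner_coef_wide _ szp) memv_suml // => i _.
have /polyOverP/(_ i)/vlineP[c ->] := Fadjoin_polyOver 1 alpha x.
rewrite -scalerAl mul1r memvZ ?memv_span //.
by apply/tnthP; exists i; rewrite tnth_mktuple.
Qed.

Lemma psiK (m : nat) :
  \dim {:L} = m -> (#|F| ^ m).-1.-primitive_root alpha ->
  cancel (psi m) (@psi_inv m).
Proof.
move=> dimL prim x; rewrite [RHS](coord_basis (power_basis dimL prim) (memvf x)).
by apply: eq_bigr => i _; rewrite mxE (nth_map i) ?size_enum_ord ?nth_ord_enum.
Qed.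

Lemma psi_invK (m : nat) :
  \dim {:L} = m -> (#|F| ^ m).-1.-primitive_root alpha ->
  cancel (@psi_inv m) (psi m).
Proof.
move=> dimL prim a; apply/colP => i; rewrite mxE.
have free_pow := basis_free (power_basis dimL prim).
rewrite -[RHS](coord_sum_free (fun j => a j 0) i free_pow); congr (coord _ _ _).
by apply: eq_bigr => j _; rewrite (nth_map j) ?size_enum_ord ?nth_ord_enum.
Qed.

End TensorProductCodes.

(* Main.v *)
(** If [s] is an involutive automorphism, the code [null_code H] contains its
    [s]-twisted dual iff [H *m (map_mx s H)^T = 0]; the Euclidean case is
    [s = id] and the Hermitian case is the Frobenius map of GF(4).  A Gram
    entry of the tensor code is the double sum over [j] and [i] of
    [l (h_j * x_i) * s (l' (h'_j * x_i))], where [x_i] is [psi^-1] of column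
    [i] of [H1], [h] and [h'] are rows of [H2], and [l], [l'] are linear forms
    on GF(q^rho1) over GF(q).  For fixed [j] each factor is a linear form in
    column [i] of [H1]; for fixed [i] it is a linear form in the coordinates
    of [h_j].  So the self-orthogonality of either component makes one of the
    two inner sums vanish. *)
Require Import Defs.
From mathcomp Require Import all_boot all_order all_algebra all_field.
From mathcomp Require Import mxtens.

Set Implicit Arguments.
Unset Strict Implicit.
Unset Printing Implicit Defensive.

Import GRing.Theory.
Local Open Scope ring_scope.

Section TwistedDual.

Variables (K : fieldType) (s : {rmorphism K -> K}).

Definition twisted_dual_containing n (C : {vspace 'rV[K]_n}) : Prop :=
  forall v : 'rV[K]_n,
    (forall u : 'rV[K]_n, u \in C -> \sum_(i < n) u 0 i * s (v 0 i) = 0) ->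
    v \in C.

Lemma twisted_prodE n (u v : 'rV[K]_n) :
  \sum_(i < n) u 0 i * s (v 0 i) = (u *m (map_mx s v)^T) 0 0.
Proof. by rewrite mxE; apply: eq_bigr => i _; rewrite !mxE. Qed.

(** The twisted dual of [null_code H] is the image under [s] of the row space of [H], so containment
    means that the rows of [map_mx s H] pass the checks of [H]. *)
Lemma twisted_dual_containing_null_code m n (H : 'M[K]_(m, n)) :
  involutive s ->
  twisted_dual_containing (null_code H) <-> H *m (map_mx s H)^T = 0.
Proof.
move=> sK; have map_sK k l (A : 'M[K]_(k, l)) : map_mx s (map_mx s A) = A.
  by apply/matrixP => i j; rewrite !mxE sK.
split=> [dualC | HH0 v vdual].
  suff HsH0 : map_mx s H *m H^T = 0.
    by rewrite -[LHS]trmxK trmx_mul trmxK HsH0 trmx0.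
  (* Each row of [map_mx s H] is in the twisted dual: a second [s] turns it back into a row of
     [H]. *)
  apply/row_matrixP => i; rewrite row_mul row0; apply/eqP.
  rewrite -mem_null_code; apply: dualC => u; rewrite mem_null_code => /eqP uH0.
  by rewrite twisted_prodE map_row map_sK tr_row colE mulmxA uH0 mul0mx mxE.
(* Double annihilator: the transposed columns of [cokermx H] are codewords, and a vector orthogonal
   to all of them lies in the row space of [H]. *)
have /submxP[w vE] : (map_mx s v <= H)%MS.
  rewrite submxE -(inj_eq trmx_inj) trmx0 trmx_mul; apply/eqP/colP => i.
  have /vdual : row i (cokermx H)^T \in null_code H.
    by rewrite mem_null_code -row_mul -trmx_mul mulmx_coker trmx0 row0.
  by rewrite twisted_prodE -row_mul !mxE.
have HsH0 : map_mx s H *m H^T = 0.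
  by rewrite -[LHS]trmxK trmx_mul trmxK HH0 trmx0.
by rewrite mem_null_code -(map_sK _ _ v) vE map_mxM -mulmxA HsH0 mulmx0.
Qed.

(** With [f] and [g] as row vectors, the sum is a product with the zero matrix [A *m (map_mx s B)^T]
    in the middle. Two matrices are allowed because the outer case pairs blocks from different rows
    of [H2]. *)
Lemma twisted_sum_eq0 m m' n (A : 'M[K]_(m, n)) (B : 'M[K]_(m', n))
    (f : 'I_m -> K) (g : 'I_m' -> K) :
  A *m (map_mx s B)^T = 0 ->
  \sum_j (\sum_k A k j * f k) * s (\sum_k B k j * g k) = 0.
Proof.
move=> AB0; pose u := \row_k f k; pose v := \row_k g k.
have -> : \sum_j (\sum_k A k j * f k) * s (\sum_k B k j * g k) =
          \sum_j (u *m A) 0 j * s ((v *m B) 0 j).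
  apply: eq_bigr => j _; rewrite !mxE; congr (_ * s _);
  by apply: eq_bigr => k _; rewrite mxE mulrC.
rewrite twisted_prodE map_mxM trmx_mul mulmxA -(mulmxA u) AB0.
by rewrite mulmx0 mul0mx mxE.
Qed.

End TwistedDual.

Section TensorGram.

Variables (F : finFieldType) (L : fieldExtType F) (alpha : L) (m : nat).
Variable s : {rmorphism F -> F}.

(** Multiplication by [y] is linear over [F], so each coordinate of the product is a linear form in
    [a] with coefficients depending only on [y] and [t]. *)
Lemma psi_psi_inv_mul (a : 'cV[F]_m) (y : L) (t : 'I_m) :
  psi alpha m (psi_inv alpha a * y) t 0 =
    \sum_k a k 0 * psi alpha m (alpha ^+ k * y) t 0.
Proof.
rewrite mxE mulr_suml linear_sum /=; apply: eq_bigr => k _.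
by rewrite -scalerAl linearZ /= mxE.
Qed.

Lemma psi_mxE k n (H : 'M[L]_(k, n)) r t j :
  psi_mx alpha m H (mxtens_index (r, t)) j = psi alpha m (H r j) t 0.
Proof. by rewrite mxE mxtens_indexK. Qed.

Variables (k n1 n2 : nat) (H2 : 'M[L]_(k, n2)) (H1 : 'M[F]_(m, n1)).

(** The factor [1] is the single row of [psi_inv_mx alpha H1]; hence the nested row indices
    below. *)
Let G : 'M[F]_(k * 1 * m, n2 * n1) :=
  psi_mx alpha m (tensmx H2 (psi_inv_mx alpha H1)).

Lemma psi_tensmxE r t j i :
  G (mxtens_index (mxtens_index (r, 0), t)) (mxtens_index (j, i)) =
  psi alpha m (H2 r j * psi_inv alpha (col i H1)) t 0.
Proof. by rewrite psi_mxE tensmxE [psi_inv_mx _ _ _ _]mxE. Qed.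

Lemma tensor_gramE r t r' t' :
  (G *m (map_mx s G)^T) (mxtens_index (mxtens_index (r, 0), t))
                        (mxtens_index (mxtens_index (r', 0), t')) =
  \sum_j \sum_i psi alpha m (H2 r j * psi_inv alpha (col i H1)) t 0 *
         s (psi alpha m (H2 r' j * psi_inv alpha (col i H1)) t' 0).
Proof.
rewrite mxE pair_bigA (reindex (@mxtens_index n2 n1)) /=; last first.
  exists (@mxtens_unindex n2 n1) => x _;
  by rewrite (mxtens_indexK, mxtens_unindexK).
apply: eq_bigr => -[j i] _.
by rewrite [_^T _ _]mxE [map_mx s G _ _]mxE !psi_tensmxE.
Qed.

Lemma tensor_gram_eq0 :
  (forall r t r' t',
    \sum_j \sum_i psi alpha m (H2 r j * psi_inv alpha (col i H1)) t 0 *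
         s (psi alpha m (H2 r' j * psi_inv alpha (col i H1)) t' 0) = 0) ->
  G *m (map_mx s G)^T = 0.
Proof.
move=> sum0; apply/matrixP => x y.
case: (mxtens_indexP x) => p t; case: (mxtens_indexP y) => p' t'.
case: (mxtens_indexP p) => r z; case: (mxtens_indexP p') => r' z'.
by rewrite !ord1 tensor_gramE sum0 mxE.
Qed.

Lemma tensor_gram_eq0_inner :
  H1 *m (map_mx s H1)^T = 0 -> G *m (map_mx s G)^T = 0.
Proof.
move=> H10; apply: tensor_gram_eq0 => r t r' t'.
apply: big1 => j _.
rewrite -[RHS](twisted_sum_eq0
  (fun l : 'I_m => psi alpha m (alpha ^+ l * H2 r j) t 0)
  (fun l : 'I_m => psi alpha m (alpha ^+ l * H2 r' j) t' 0) H10).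
apply: eq_bigr => i _; rewrite ![H2 _ _ * _]mulrC !psi_psi_inv_mul.
by congr (_ * s _); apply: eq_bigr => l _; rewrite mxE.
Qed.

Lemma tensor_gram_eq0_outer :
  \dim {:L} = m -> (#|F| ^ m).-1.-primitive_root alpha ->
  psi_mx alpha m H2 *m (map_mx s (psi_mx alpha m H2))^T = 0 ->
  G *m (map_mx s G)^T = 0.
Proof.
move=> dimL prim H20; apply: tensor_gram_eq0 => r t r' t'.
rewrite exchange_big; apply: big1 => i _.
(* [A r] is the block of [m] rows that row [r] of [H2] contributes to [psi_mx alpha m H2]. *)
pose A r := rowsub (fun l : 'I_m => mxtens_index (r, l)) (psi_mx alpha m H2).
have A0 : A r *m (map_mx s (A r'))^T = 0.
  rewrite map_mxsub trmx_mxsub -mxsub_mul H20.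
  by apply/matrixP => a b; rewrite !mxE.
rewrite -[RHS](twisted_sum_eq0
  (fun l : 'I_m => psi alpha m (alpha ^+ l * psi_inv alpha (col i H1)) t 0)
  (fun l : 'I_m => psi alpha m (alpha ^+ l * psi_inv alpha (col i H1)) t' 0) A0).
apply: eq_bigr => j _.
(* Entries of [H2] are expanded in the basis of powers of [alpha]; their coordinates are the entries
   of the blocks. *)
rewrite -[H2 r j](psiK dimL prim) -[H2 r' j](psiK dimL prim) !psi_psi_inv_mul.
by congr (_ * s _); apply: eq_bigr => l _; rewrite [A _ _ _]mxE psi_mxE.
Qed.

Hypotheses (sK : involutive s) (dimL : \dim {:L} = m).
Hypothesis prim : (#|F| ^ m).-1.-primitive_root alpha.

Lemma tensor_twisted_dual_containing :
  twisted_dual_containing s (null_code H1) \/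
    twisted_dual_containing s (subfield_code alpha m H2) ->
  twisted_dual_containing s (tensor_product_code alpha H2 H1).
Proof.
rewrite /subfield_code /tensor_product_code.
move=> dual12; apply/(twisted_dual_containing_null_code _ sK).
case: dual12 => /(twisted_dual_containing_null_code _ sK).
  exact: tensor_gram_eq0_inner.
exact: tensor_gram_eq0_outer.
Qed.

End TensorGram.

Theorem lemma6 (q : nat) (hq : q = 2%N \/ q = 4%N)
    (F : finFieldType) (hF : #|F| = q)
    (n1 k1 d1 rho1 : nat) (C1 : {vspace 'rV[F]_n1})
    (hC1 : linear_code C1 k1 d1) (hrho1 : rho1 = (n1 - k1)%N)
    (L : fieldExtType F) (hL : \dim {:L} = rho1)
    (alpha : L) (halpha : (q ^ rho1).-1.-primitive_root alpha)
    (n2 k2 d2 rho2 : nat) (C2 : {vspace 'rV[L]_n2})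
    (hC2 : linear_code C2 k2 d2) (hrho2 : rho2 = (n2 - k2)%N)
    (H1 : 'M[F]_(rho1, n1)) (hH1 : parity_check_matrix C1 H1)
    (H2 : 'M[L]_(rho2, n2)) (hH2 : parity_check_matrix C2 H2) :
  (euclid_dual_containing C1 \/
     euclid_dual_containing (subfield_code alpha rho1 H2) ->
   euclid_dual_containing (tensor_product_code alpha H2 H1)) /\
  (q = 4%N ->
   herm_dual_containing C1 \/
     herm_dual_containing (subfield_code alpha rho1 H2) ->
   herm_dual_containing (tensor_product_code alpha H2 H1)).
Proof.
have prim : (#|F| ^ rho1).-1.-primitive_root alpha by rewrite hF.
rewrite -hH1; split.
  by apply: (@tensor_twisted_dual_containing _ _ _ _ idfun).
move=> q4; have char2 : 2%N \in [pchar F].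
  by apply: (@card_finPcharP _ _ 2) => //; rewrite hF q4.
  (* Squaring twice is the identity because x^4 = x on a field of four elements. *)
  have frobK : involutive (pFrobenius_aut char2).
  by move=> x; rewrite !pFrobenius_autE -exprM -[RHS]expf_card hF q4.
exact: (@tensor_twisted_dual_containing _ _ _ _ (pFrobenius_aut char2)).
Qed.
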